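(* Let $\Omega:\mathbb{R}^n\to\mathbb{R}$ be a positive weight and $\nu$ a probability measure on $\mathbb{R}^n$. Suppose that $\nu$ satisfies the weighted logarithmic Sobolev inequality with weight $\Omega$ and constant $C>0$. Then, for all $f\in\mathcal{C}^1(\mathbb{R}^n)$ such that $\|\Omega|df|^2\|_\infty<\infty$ and for all $t\in\mathbb{R}$, $$\nu\left(e^{tf}\right)\leq\exp\left(t\,\nu(f)+\frac{C\,\|\Omega|df|^2\|_\infty}{4}t^2\right).$$
   Context: A probability measure $\nu$ on $\mathbb{R}^n$ satisfies the logarithmic Sobolev inequality with weight $\Omega$ and constant $C>0$ if $$\operatorname{Ent}_\nu(f^2)\leq C\int_{\mathbb{R}^n}|df|^2\,\Omega\,d\nu\quad\text{for all } f\in\mathcal{C}_c^\infty(\mathbb{R}^n),$$ where $\mathcal{C}_c^\infty(\mathbb{R}^n)$ is the set of smooth compactly supported functions; whenever this inequality holds, it is understood as extended to a domain in $L^2(\nu)$. Here $\operatorname{Ent}_\nu(g)=\int g\log g\,d\nu-\left(\int g\,d\nu\right)\log\left(\int g\,d\nu\right)$ for $g\ge0$, $|df|$ is the Euclidean norm of the gradient, $\nu(g)=\int g\,d\nu$, and $\|\cdot\|_\infty$ is the supremum norm.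
   Formalization: The log-Sobolev inequality is assumed not only for smooth compactly supported functions but for all C^1 functions in L^2(ν) with finite weighted energy (the ''domain in L^2(ν)''); for compactly supported functions and their closure alone the claim fails. The weight is taken Borel measurable. *)

(* Defs.v *)
From HB Require Import structures.
From mathcomp Require Import all_boot all_order all_algebra.
From mathcomp Require Import all_classical all_reals all_analysis.

Set Implicit Arguments.
Unset Strict Implicit.
Unset Printing Implicit Defensive.

Import Order.TTheory GRing.Theory Num.Theory.
Import numFieldTopology.Exports numFieldNormedType.Exports.

Local Open Scope classical_set_scope.
Local Open Scope ring_scope.

(* R^n carrying its Borel sigma-algebra.  The library's norm on 'rV[R]_n is the
   sup norm; it is used only for the (norm-independent) topology and for
   differentiability, and the Euclidean norm of the gradient is spelled out. *)
Definition borelRn (R : realType) (n : nat) :=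
  g_sigma_algebraType (@open 'rV[R]_n).

Section Smoothness.
Context (R : realType) (n : nat).
Implicit Types (f : 'rV[R]_n -> R).

Definition partial (i : 'I_n) f : 'rV[R]_n -> R :=
  fun x => 'D_(delta_mx 0 i) f x.

Definition grad_norm f (x : 'rV[R]_n) : R :=
  Num.sqrt (\sum_(i < n) partial i f x ^+ 2).

Fixpoint Ck (k : nat) f : Prop :=
  if k is k'.+1 then
    (forall x, differentiable f x) /\ (forall i, Ck k' (partial i f))
  else continuous f.

Definition Cinfty f : Prop := forall k, Ck k f.

Definition Cc_infty : set ('rV[R]_n -> R) :=
  [set f | Cinfty f /\ compact (closure [set x | f x != 0])].

Definition sup_norm f : \bar R := ereal_sup (range (fun x => `|f x|%:E)).

End Smoothness.

Section LogSobolev.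
Context (R : realType) (n : nat).
Variable nu : probability (borelRn R n) R.
Implicit Types (f g Omega : 'rV[R]_n -> R).

(* Meant for nu-integrable g >= 0.  Then the integral of g * ln g is well
   defined in ]-oo, +oo] (g * ln g >= -1), and the convention 0 log 0 = 0 holds
   because ln 0 = 0. *)
Definition Ent g : \bar R :=
  (\int[nu]_x (g x * ln (g x))%:E
   - ((\int[nu]_x g x)%R * ln (\int[nu]_x g x)%R)%:E)%E.

Definition energy Omega f : \bar R :=
  (\int[nu]_x (grad_norm f x ^+ 2 * Omega x)%:E)%E.

Definition energy_domain Omega : set ('rV[R]_n -> R) :=
  [set f | [/\ Ck 1 f,
               nu.-integrable [set: borelRn R n] (fun x => (f x ^+ 2)%:E) &
               (energy Omega f < +oo)%E]].

(* The inequality for test functions, together with its extension to the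
   finite-energy C^1 functions of L^2(nu).  The extension has to be part of the
   definition: when the metric |dx|^2 / Omega is incomplete it does not follow
   from the inequality for test functions.  For instance, if phi is a smooth
   increasing bijection from R to ]0, 1[, d nu = phi' dx and
   Omega = phi' ^- 2, then test functions only see the uniform law on ]0, 1[
   with Dirichlet boundary conditions, whose constant 1 / (2 pi^2) is too small
   for the sub-Gaussian bound applied to phi. *)
Definition weighted_log_sobolev Omega (C : R) : Prop :=
  forall f, (@Cc_infty R n `|` energy_domain Omega) f ->
    (Ent (fun x => (f x ^+ 2)%R) <= C%:E * energy Omega f)%E.

End LogSobolev.

(* Main.v *)
Require Import Defs.
From HB Require Import structures.
From mathcomp Require Import all_boot all_order all_algebra.
From mathcomp Require Import all_classical all_reals all_analysis.
From mathcomp Require Import measurable_realfun.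
From mathcomp Require Import ring lra.

(** The proof is Herbst's argument followed by a truncation.

    For a bounded C^1 function g with Omega |dg|^2 <= L, the logarithmic Sobolev
    inequality applied to e^(sg/2) reads, with H(s) = nu(e^(sg)) and c = CL/4,
      s H'(s) - H(s) ln H(s) <= c s^2 H(s),
    that is, ln H(s) / s - c s has a nonpositive derivative for s > 0.  Since
    ln H(s) / s tends to H'(0) = nu(g) as s tends to 0, this gives
    ln H(t) <= t nu(g) + c t^2 for t > 0; negative t follow by changing g into
    -g ([herbst]).

    An unbounded f is replaced by f_k = f / (1 + f^2 / (k+1)), which is bounded
    and C^1, converges to f, and satisfies |f_k| <= |f| and |df_k| <= |df|; so the
    bounded case applies to f_k with the same constant ([lsi_laplace_bounded]).
    The bound for f_k then goes to the limit ([laplace_limit]).  The point there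
    is that the means nu(f_k) stay bounded: e^(tf_k) >= e^(-|f|) for t = 1 and
    t = -1, hence 0 < nu(e^(-|f|)) <= e^(t nu(f_k) + c), which bounds nu(f_k) from
    both sides.  Fatou's lemma then makes e^f and e^(-f), hence f, integrable;
    dominated convergence gives nu(f_k) --> nu(f), and a second use of Fatou's
    lemma gives the bound for f. *)

Set Implicit Arguments.
Unset Strict Implicit.
Unset Printing Implicit Defensive.

Import Order.TTheory GRing.Theory Num.Theory.
Import numFieldTopology.Exports numFieldNormedType.Exports.

Local Open Scope classical_set_scope.
Local Open Scope ring_scope.

(** * Laplace transforms on a probability space *)

Section Laplace.
Context d (T : measurableType d) (R : realType) (P : probability T R).
Implicit Types g : T -> R.

Lemma le_bounded_integrable g (M : R) : measurable_fun setT g ->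
  (forall x, `|g x| <= M) -> P.-integrable setT (EFin \o g).
Proof.
move=> mg gM; apply: measurable_bounded_integrable => //.
  exact: fin_num_fun_lty (fin_num_measure P).
exists M; split; first exact: num_real.
by move=> y My x _; exact: le_trans (gM x) (ltW My).
Qed.

Lemma Rintegral_cst1 (r : R) : (\int[P]_x r)%R = r.
Proof.
rewrite Rintegral_cst//; set p := fine _.
by have -> : p = 1; [exact: (congr1 fine (probability_setT P))|rewrite mulr1].
Qed.

Lemma measurable_expRM (t : R) g :
  measurable_fun setT g -> measurable_fun setT (fun x => expR (t * g x)).
Proof. by move=> mg; apply: measurableT_comp => //; exact: measurable_funM. Qed.

Lemma expRM_le (t M y : R) : `|y| <= M -> expR (t * y) <= expR (`|t| * M).
Proof.
move=> yM; rewrite ler_expR (le_trans (ler_norm _))// normrM.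
by rewrite ler_wpM2l.
Qed.

Section bounded.
Variables (g : T -> R) (M : R).
Hypotheses (mg : measurable_fun setT g) (gM : forall x, `|g x| <= M).

Lemma integrable_expRM (t : R) :
  P.-integrable setT (EFin \o (fun x => expR (t * g x))).
Proof.
apply: (@le_bounded_integrable _ (expR (`|t| * M))).
  exact: measurable_expRM.
by move=> x; rewrite ger0_norm ?expR_ge0// expRM_le.
Qed.

Lemma integrable_mul_expRM (t : R) :
  P.-integrable setT (EFin \o (fun x => g x * expR (t * g x))).
Proof.
apply: (@le_bounded_integrable _ (M * expR (`|t| * M))).
  by apply: measurable_funM => //; exact: measurable_expRM.
move=> x; rewrite normrM ler_pM// ger0_norm ?expR_ge0//.
exact: expRM_le.
Qed.

Let H (t : R) : R := (\int[P]_x expR (t * g x))%R.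

Lemma laplace_gt0 (t : R) : 0 < H t.
Proof.
apply: (@lt_le_trans _ _ (expR (- (`|t| * M)))); first exact: expR_gt0.
have -> : expR (- (`|t| * M)) = (\int[P]_x expR (- (`|t| * M)))%R.
  by rewrite Rintegral_cst1.
apply: le_Rintegral => //.
- apply: (@le_bounded_integrable _ (expR (- (`|t| * M)))) => // x.
  by rewrite ger0_norm ?expR_ge0.
- exact: integrable_expRM.
- move=> x _; rewrite ler_expR lerNl -mulNr (le_trans (ler_norm _))//.
  by rewrite normrM normrN ler_wpM2l.
Qed.

(** On ]t - 1, t + 1[ the derivative of the integrand is at most
    M e^((|t| + 1) M), which allows differentiation under the integral. *)
Lemma is_derive_laplace (t : R) :
  is_derive t 1 H (\int[P]_x (g x * expR (t * g x)))%R.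
Proof.
have M0 : 0 <= M by rewrite (le_trans _ (gM point)).
have dE (s : R) (y : R) :
    is_derive s 1 (fun s : R => expR (s * y)) (y * expR (s * y)).
  apply: is_derive_eq.
  by rewrite /GRing.scale/= mulr0 add0r mulr1 mulrC.
have It : `]t - 1, t + 1[%classic t.
  by rewrite /= in_itv/= ltrBlDr ltrDl ltr01.
have d1E (s : R) x :
    partial1of2 (fun s x => expR (s * g x)) s x = g x * expR (s * g x).
  by rewrite /partial1of2 derive1E; exact: derive_val.
pose G (x : T) : R := M * expR ((`|t| + 1) * M).
have G0 y : 0 <= G y by rewrite mulr_ge0 ?expR_ge0.
have iG : P.-integrable setT (EFin \o G).
  by apply: (@le_bounded_integrable _ (G point)) => [|x]; [exact: measurable_cst|rewrite ger0_norm].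
have Gub (s : R) y : `]t - 1, t + 1[%classic s -> [set: T] y ->
    `|partial1of2 (fun s x => expR (s * g x)) s y| <= G y.
  rewrite /= in_itv/= => /andP[s1 s2] _; rewrite d1E normrM ler_pM//.
  rewrite ger0_norm ?expR_ge0// (le_trans (expRM_le s (gM y)))//.
  rewrite ler_expR ler_wpM2r// -lerBlDl.
  rewrite (le_trans (lerB_dist _ _))// ler_norml; lra.
have int (s : R) : `]t - 1, t + 1[%classic s ->
    P.-integrable setT (EFin \o (fun x => expR (s * g x))).
  by move=> _; exact: integrable_expRM.
have der (s : R) y : `]t - 1, t + 1[%classic s -> [set: T] y ->
    derivable (fun s : R => expR (s * g y)) s 1.
  by move=> _ _; exact: ex_derive.
apply: DeriveDef.
  exact: (derivable_under_integral measurableT It int der G0 iG Gub).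
rewrite -derive1E.
rewrite (differentiation_under_integral measurableT It int der G0 iG Gub).
by apply: eq_Rintegral => x _; exact: d1E.
Qed.

Lemma laplace0 : H 0 = 1.
Proof.
rewrite /H; under eq_Rintegral do rewrite mul0r expR0.
by rewrite Rintegral_cst1.
Qed.

(** The entropy hypothesis says that K(s) = ln H(s) / s - c s is nonincreasing on
    the positive reals, so K(t) is at most its limit at 0.  As only that
    inequality is needed, ln y <= y - 1 reduces the limit of ln H(s) / s to that
    of the difference quotient of H at 0. *)
Lemma herbst_pos (c : R) :
  (forall s, (\int[P]_x (s * g x * expR (s * g x)))%R - H s * ln (H s)
     <= c * s ^+ 2 * H s) ->
  forall t, 0 < t -> H t <= expR (t * (\int[P]_x g x)%R + c * t ^+ 2).
Proof.
move=> ent t t0.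
pose K (s : R) := ln (H s) / s - c * s.
pose H' (s : R) := (\int[P]_x (g x * expR (s * g x)))%R.
have dK (s : R) : 0 < s ->
    is_derive s 1 K ((s * H' s - H s * ln (H s)) / (s ^+ 2 * H s) - c).
  move=> s0; have dH := is_derive_laplace s.
  have dl : is_derive s 1 (@ln R \o H) ((H s)^-1 * H' s).
    apply: is_derive_eq; first exact: is_derive1_comp (is_derive1_ln (laplace_gt0 s)) dH.
    by [].
  have dV : is_derive s 1 (fun s : R => s^-1) (- s ^- 2).
    have s0' : s != 0 by rewrite gt_eqF.
    apply: DeriveDef; first exact: derivableV.
    rewrite deriveV// derive_id /GRing.scale/= mulr1//.
  have -> : K = (@ln R \o H) * (fun s : R => s^-1) - c *: (id : R -> R).
    by apply/funext => y; rewrite /K /= !fctE.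
  apply: is_derive_eq.
  rewrite /GRing.scale/= mulr1; congr (_ - _).
  have := laplace_gt0 s => Hs0; field.
  by rewrite !gt_eqF.
have Kle (s : R) : 0 < s -> s <= t -> K t <= K s.
  move=> s0 st.
  apply: (@ler0_derive1_nincr _ K s t) => //.
  - move=> x; rewrite in_itv/= => /andP[sx _].
    by have [] := dK _ (lt_trans s0 sx).
  - move=> x; rewrite in_itv/= => /andP[sx _].
    have x0 := lt_trans s0 sx.
    rewrite derive1E; have [_ ->] := dK _ x0.
    rewrite subr_le0 ler_pdivrMr ?mulr_gt0 ?exprn_gt0 ?laplace_gt0//.
    rewrite mulrA; apply: le_trans (ent x); rewrite lerD2r /H'.
    rewrite -RintegralZl//; last exact: integrable_mul_expRM.
    by under eq_Rintegral do rewrite mulrA.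
  - apply: derivable_within_continuous => x; rewrite in_itv/= => /andP[sx _].
    by have [] := dK _ (lt_le_trans s0 sx).
have Kt (s : R) : 0 < s -> s <= t -> K t + c * s <= s^-1 * (H s - H 0).
  move=> s0 st; rewrite laplace0 [leRHS]mulrC ler_pdivlMr//.
  apply: (@le_trans _ _ (ln (H s))).
    have := Kle s s0 st; rewrite {2}/K lerBrDr => h.
    by rewrite -ler_pdivlMr.
  have := @le_ln1Dx R (H s - 1); rewrite [1 + _]addrC subrK; apply.
  by rewrite ltrBrDl subrr laplace_gt0.
have : K t <= (\int[P]_x g x)%R.
  have dH0 := is_derive_laplace 0.
  have cH : (fun h : R => h^-1 * (H h - H 0) - c * h) @ 0^'+ -->
      (\int[P]_x g x)%R - c * 0.
    apply: cvgB; last first.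
      by apply: cvg_at_right_filter; apply: cvgM; [exact: cvg_cst|exact: cvg_id].
    apply: cvg_dnbhs_at_right.
    have -> : (\int[P]_x g x)%R = 'D_1 H 0.
      rewrite derive_val; apply: eq_Rintegral => x _.
      by rewrite mul0r expR0 mulr1.
    have := @ex_derive _ _ _ _ _ _ _ dH0 => /cvg_ex[l hl].
    rewrite /derive (cvg_lim _ hl)//.
    move: hl; apply: cvg_trans; apply: near_eq_cvg; near=> h => /=.
    by rewrite addr0 [h%:A]mulr1.
  rewrite mulr0 subr0 in cH.
  apply: (cvgr_to_ge cH); near=> s.
  rewrite lerBrDr; apply: Kt.
    by near: s; exact: nbhs_right_gt.
  by near: s; exact: nbhs_right_le.
rewrite /K lerBlDr ler_pdivrMr// => h.
by rewrite -ler_ln ?posrE ?laplace_gt0 ?expR_gt0// expRK; lra.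
Unshelve. all: by end_near. Qed.

End bounded.

Lemma herbst (g : T -> R) (M c : R) :
  measurable_fun setT g -> (forall x, `|g x| <= M) ->
  (forall s, (\int[P]_x (s * g x * expR (s * g x)))%R -
     (\int[P]_x expR (s * g x))%R * ln (\int[P]_x expR (s * g x))%R
     <= c * s ^+ 2 * (\int[P]_x expR (s * g x))%R) ->
  forall t, (\int[P]_x expR (t * g x))%R <=
            expR (t * (\int[P]_x g x)%R + c * t ^+ 2).
Proof.
move=> mg gM ent t.
have [t0|t0|->] := ltgtP t 0; last 2 first.
- exact: (herbst_pos mg gM ent).
- by rewrite (laplace0 g) mul0r expr0n/= mulr0 addr0 expR0.
pose h x := - g x.
have mh : measurable_fun setT h by exact: measurableT_comp.
have hM x : `|h x| <= M by rewrite normrN.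
have gh s x : s * h x = - s * g x by rewrite mulrN mulNr.
have enth s : (\int[P]_x (s * h x * expR (s * h x)))%R -
     (\int[P]_x expR (s * h x))%R * ln (\int[P]_x expR (s * h x))%R
     <= c * s ^+ 2 * (\int[P]_x expR (s * h x))%R.
  have e1 : (\int[P]_x expR (s * h x))%R = (\int[P]_x expR (- s * g x))%R.
    by apply: eq_Rintegral => x _; rewrite gh.
  have e2 : (\int[P]_x (s * h x * expR (s * h x)))%R =
      (\int[P]_x (- s * g x * expR (- s * g x)))%R.
    by apply: eq_Rintegral => x _; rewrite gh.
  by rewrite e1 e2 -sqrrN.
have := herbst_pos mh hM enth (t := - t).
rewrite oppr_gt0 => /(_ t0); rewrite sqrrN.
under eq_Rintegral do rewrite gh opprK.
suff -> : (\int[P]_x h x)%R = - (\int[P]_x g x)%R by rewrite mulrNN.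
rewrite -[RHS]mulN1r -RintegralZl//; last exact: le_bounded_integrable gM.
by apply: eq_Rintegral => x _; rewrite mulN1r.
Qed.

Lemma fin_num_integral (g : T -> R) :
  P.-integrable setT (EFin \o g) -> (\int[P]_x (g x)%:E)%E \is a fin_num.
Proof. by move=> ig; have h := integrable_fin_num measurableT ig. Qed.

(** The form in which Fatou's lemma is used: upper bounds on integrals pass to a
    pointwise limit. *)
Lemma fatou_le (g_ : nat -> T -> R) (g : T -> R) (b : nat -> \bar R) (l : \bar R) :
  (forall n, measurable_fun setT (g_ n)) -> (forall n x, 0 <= g_ n x) ->
  (forall x, g_ n x @[n --> \oo] --> g x) ->
  (forall n, (\int[P]_x (g_ n x)%:E <= b n)%E) -> b @ \oo --> l ->
  (\int[P]_x (g x)%:E <= l)%E.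
Proof.
move=> mg_ g0 g_g gb bl.
have -> : (\int[P]_x (g x)%:E = \int[P]_x limn_einf (fun n => (g_ n x)%:E))%E.
  apply: eq_integral => x _.
  have gx : (g_ n x)%:E @[n --> \oo] --> (g x)%:E.
    by apply: cvg_EFin; [exact: nearW|exact: g_g].
  by have [-> _] := cvg_limn_einf_sup gx.
apply: (@le_trans _ _ (limn_einf (fun n => \int[P]_x (g_ n x)%:E)%E)).
  apply: (@fatou _ _ _ P setT measurableT (fun n x => (g_ n x)%:E)).
  - by move=> n; apply/measurable_EFinP.
  - by move=> n x _; rewrite lee_fin.
have [<- _] := cvg_limn_einf_sup bl.
rewrite !limn_einf_lim; apply: lee_lim; [exact: is_cvg_einfs..|].
apply: nearW => n; apply: le_ereal_inf_tmp => _ [k /= nk <-].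
by apply: le_trans (gb k); apply: ereal_inf_lbound; exists k.
Qed.

(** The only information on f itself is that it is finite, so the bound on the
    means of f_n comes from e^(-|f|) having a positive integral. *)
Lemma laplace_limit (f : T -> R) (f_ : nat -> T -> R) (M : nat -> R) (c : R) :
  measurable_fun setT f -> (forall n, measurable_fun setT (f_ n)) ->
  (forall n x, `|f_ n x| <= `|f x|) -> (forall n x, `|f_ n x| <= M n) ->
  (forall x, f_ n x @[n --> \oo] --> f x) ->
  (forall n t, (\int[P]_x expR (t * f_ n x))%R <=
     expR (t * (\int[P]_x f_ n x)%R + c * t ^+ 2)) ->
  P.-integrable setT (EFin \o f) /\
  forall t, (\int[P]_x (expR (t * f x))%:E <=
     (expR (t * (\int[P]_x f x)%R + c * t ^+ 2))%:E)%E.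
Proof.
move=> mf mf_ f_f f_M f_cvg bnd.
pose m n := (\int[P]_x f_ n x)%R.
have lapl n t : (\int[P]_x (expR (t * f_ n x))%:E <=
    (expR (t * m n + c * t ^+ 2))%:E)%E.
  have i := integrable_expRM (mf_ n) (f_M n) t.
  rewrite -[leLHS]fineK ?lee_fin; first exact: bnd.
  exact: fin_num_integral i.
have expcvg t x : expR (t * f_ n x) @[n --> \oo] --> expR (t * f x).
  apply: (@cvg_comp _ _ _ (fun n => t * f_ n x) expR); last exact: continuous_expR.
  by apply: cvgM; [exact: cvg_cst|exact: f_cvg].
have fat t (b : nat -> \bar R) l :
    (forall n, ((expR (t * m n + c * t ^+ 2))%:E <= b n)%E) -> b @ \oo --> l ->
    (\int[P]_x (expR (t * f x))%:E <= l)%E.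
  move=> mb bl; apply: (@fatou_le (fun n x => expR (t * f_ n x)) _ b) => //.
  - by move=> n; exact: measurable_expRM.
  - by move=> n; exact: le_trans (lapl n t) (mb n).
(* [i0] is a lower bound, uniform in n, of the Laplace transforms at 1 and -1. *)
pose i0 := (\int[P]_x expR (- `|f x|))%R.
have mN : measurable_fun setT (fun x => expR (- `|f x|)).
  by do 3 apply: measurableT_comp => //.
have N1 x : `|expR (- `|f x|)| <= 1.
  by rewrite ger0_norm ?expR_ge0// -expR0 ler_expR oppr_le0.
have iN : P.-integrable setT (EFin \o (fun x => expR (- `|f x|))).
  exact: le_bounded_integrable N1.
have i00 : 0 < i0.
  rewrite lt_neqAle Rintegral_ge0 ?andbT; last by move=> x _; exact: expR_ge0.
  apply/negP => /eqP i0E.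
  have : (\int[P]_x `|(expR (- `|f x|))%:E| = 0)%E.
    under eq_integral do rewrite gee0_abs ?lee_fin ?expR_ge0//.
    rewrite -[LHS]fineK; first by congr EFin.
    exact: fin_num_integral iN.
  move/(ae_eq_integral_abs P measurableT) => /(_ _)[|A [mA PA0 sub]].
    exact/measurable_EFinP.
  have AT : A = setT.
    rewrite -subTset => x _; apply: sub => /= /(_ Logic.I) [].
    by apply/eqP; rewrite gt_eqF ?expR_gt0.
  have := probability_setT P; rewrite -AT PA0 => /eqP.
  by rewrite eqe eq_sym oner_eq0.
have sqr1 (t : R) : `|t| = 1 -> t ^+ 2 = 1.
  by move=> t1; rewrite -[t ^+ 2]real_normK ?num_real// t1 expr1n.
pose B := c - ln i0.
have mB n (t : R) : `|t| = 1 -> - (t * m n) <= B.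
  move=> t1.
  have : i0 <= expR (t * m n + c * t ^+ 2).
    apply: le_trans (bnd n t); apply: le_Rintegral => //.
      exact: integrable_expRM (mf_ n) (f_M n) t.
    move=> x _; rewrite ler_expR lerNl (le_trans (ler_norm _))//.
    by rewrite normrN normrM t1 mul1r.
  by rewrite -ler_ln ?posrE ?expR_gt0// expRK sqr1// /B; lra.
have fin (t : R) : `|t| = 1 -> (\int[P]_x (expR (t * f x))%:E < +oo)%E.
  move=> t1; apply: (@le_lt_trans _ _ (expR (B + c))%:E); last exact: ltry.
  apply: (fat _ (fun=> (expR (B + c))%:E)); last exact: cvg_cst.
  move=> n; rewrite lee_fin ler_expR.
  rewrite sqr1// mulr1 lerD2r.
  by have := mB n (- t); rewrite normrN mulNr opprK; exact.
have ie (t : R) : `|t| = 1 -> P.-integrable setT (EFin \o (fun x => expR (t * f x))).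
  move=> t1; apply/integrableP; split.
    by apply/measurable_EFinP; exact: measurable_expRM.
  under eq_integral do rewrite /= ger0_norm ?expR_ge0//.
  exact: fin.
have intf : P.-integrable setT (EFin \o f).
  apply: (le_integrable measurableT _ _
    (integrableD measurableT (ie 1 _) (ie (-1) _))).
  - exact/measurable_EFinP.
  (* |y| <= e^y + e^(-y), because 1 + y <= e^y. *)
  - move=> x _ /=; rewrite lee_fin mul1r mulN1r.
    rewrite [leRHS]ger0_norm ?addr_ge0 ?expR_ge0// ler_norml.
    have := expR_ge1Dx (f x); have := expR_ge1Dx (- f x).
    have := expR_gt0 (f x); have := expR_gt0 (- f x); lra.
  - exact: normr1.
  - by rewrite normrN1.
split => // t.
apply: (fat _ (fun n => (expR (t * m n + c * t ^+ 2))%:E)) => //.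
apply: cvg_EFin; first exact: nearW.
apply: (@cvg_comp _ _ _ (fun n => t * m n + c * t ^+ 2) expR);
  last exact: continuous_expR.
apply: cvgD; last exact: cvg_cst.
apply: cvgM; first exact: cvg_cst.
apply: fine_cvg; rewrite fineK; last exact: fin_num_integral intf.
have [] := @dominated_convergence _ _ _ P setT measurableT
  (fun n x => (f_ n x)%:E) (EFin \o f) (fun x => `|(f x)%:E|%E) => //.
- by move=> n; apply/measurable_EFinP.
- exact/measurable_EFinP.
- by apply: aeW => x _; apply: cvg_EFin; [exact: nearW|exact: f_cvg].
- exact: integrable_abse.
- by apply: aeW => x n _; rewrite /= lee_fin.
Qed.

End Laplace.

(** * Composition with a function of one variable *)

Section Chain.
Context (R : realType) (n : nat).
Implicit Types (f : 'rV[R]_n -> R) (phi dphi : R -> R).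

Lemma continuous_borelRn f :
  continuous f -> measurable_fun [set: borelRn R n] (f : borelRn R n -> R).
Proof.
move=> /continuousP cf; apply: (measurability _ (RGenOpens.measurableE R)).
move=> _ [_ [a [b ->] <-]]; rewrite setTI.
by apply: sub_sigma_algebra; apply: cf; exact: interval_open.
Qed.

Lemma partial_comp i f phi (d : R) x :
  differentiable f x -> is_derive (f x) 1 phi d ->
  partial i (phi \o f) x = d * partial i f x.
Proof.
move=> df dphi.
have dp : differentiable phi (f x) by apply/derivable1_diffP; case: dphi.
rewrite /partial deriveE; last exact: differentiable_comp.
rewrite diff_comp// /comp diff1E// derive1E (@derive_val _ _ _ _ _ _ _ dphi).
by rewrite deriveE// mulrC.
Qed.

Lemma Ck1_comp f phi dphi : Ck 1 f ->
  (forall y : R, is_derive y 1 phi (dphi y)) -> continuous dphi ->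
  Ck 1 (phi \o f).
Proof.
move=> [df cf] dphiP cdphi; split=> [x|i].
  apply: differentiable_comp => //.
  by apply/derivable1_diffP; case: (dphiP (f x)).
have -> : partial i (phi \o f) = (dphi \o f) * partial i f.
  by apply/funext => x; exact: partial_comp.
move=> x; apply: continuousM; last exact: cf.
apply: continuous_comp; last exact: cdphi.
exact: differentiable_continuous.
Qed.

Lemma grad_norm_sqr f x :
  grad_norm f x ^+ 2 = \sum_(i < n) partial i f x ^+ 2.
Proof. by rewrite sqr_sqrtr// sumr_ge0// => i _; exact: sqr_ge0. Qed.

Lemma grad_norm_comp f phi (d : R) x :
  differentiable f x -> is_derive (f x) 1 phi d ->
  grad_norm (phi \o f) x ^+ 2 = d ^+ 2 * grad_norm f x ^+ 2.
Proof.
move=> df dphi; rewrite !grad_norm_sqr mulr_sumr; apply: eq_bigr => i _.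
by rewrite (partial_comp _ df dphi) exprMn.
Qed.

Lemma measurable_grad_norm_sqr f : Ck 1 f ->
  measurable_fun [set: borelRn R n]
    ((fun x => grad_norm f x ^+ 2) : borelRn R n -> R).
Proof.
move=> [_ cf]; apply: continuous_borelRn.
have -> : (fun x => grad_norm f x ^+ 2) =
    (fun x => \sum_(i < n) partial i f x ^+ 2).
  by apply/funext => x; exact: grad_norm_sqr.
apply: continuous_big => [|i _ x]; first exact: add_continuous.
by apply: continuousM; exact: cf.
Qed.

End Chain.

(** * The bounded case of the sub-Gaussian bound *)

Section LSI.
Context (R : realType) (n : nat).
Variables (nu : probability (borelRn R n) R).
Variables (Omega : 'rV[R]_n -> R) (C : R).
Hypothesis Omega_meas :
  measurable_fun [set: borelRn R n] (Omega : borelRn R n -> R).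
Hypothesis Omega_gt0 : forall x, 0 < Omega x.
Hypothesis C_gt0 : 0 < C.
Hypothesis wlsi : weighted_log_sobolev nu Omega C.

(** The logarithmic Sobolev inequality is applied to h = e^(sg/2), for which
    h^2 = e^(sg) and |dh|^2 = (s^2 / 4) e^(sg) |dg|^2. *)
Lemma lsi_laplace_bounded (g : 'rV[R]_n -> R) (M L : R) :
  Ck 1 g -> (forall x, `|g x| <= M) ->
  (forall x, Omega x * grad_norm g x ^+ 2 <= L) ->
  forall t, (\int[nu]_x expR (t * g x))%R <=
            expR (t * (\int[nu]_x g x)%R + C * L / 4 * t ^+ 2).
Proof.
move=> Cg gM gL.
have mg : measurable_fun [set: borelRn R n] (g : borelRn R n -> R).
  by apply: continuous_borelRn => x; apply: differentiable_continuous; case: Cg.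
apply: (herbst mg gM) => s.
pose phi y := expR (s / 2 * y).
have dphi (y : R) : is_derive y 1 phi (s / 2 * phi y).
  apply: is_derive_eq.
  by rewrite /GRing.scale/= mulr1 mulrC.
pose h := phi \o g.
have h2 x : h x ^+ 2 = expR (s * g x).
  by rewrite /h /phi/= -expRM_natl; congr expR; field.
have Ch : Ck 1 h.
  apply: (Ck1_comp Cg dphi) => y; apply: cvgM; first exact: cvg_cst.
  by apply/differentiable_continuous/derivable1_diffP; case: (dphi y).
have iE := integrable_expRM nu mg gM s.
have iME : nu.-integrable setT (EFin \o (fun x => s * g x * expR (s * g x))).
  have := integrableZl measurableT s (integrable_mul_expRM nu mg gM s).
  by apply: eq_integrable => // x _; rewrite /= -EFinM mulrA.
set H := (\int[nu]_x expR (s * g x))%R.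
have en : (energy nu Omega h <= (s ^+ 2 / 4 * L * H)%:E)%E.
  have -> : ((s ^+ 2 / 4 * L * H)%:E =
      \int[nu]_x (s ^+ 2 / 4 * L * expR (s * g x))%:E)%E.
    rewrite /H -RintegralZl// fineK//.
    apply: fin_num_integral.
    have := integrableZl measurableT (s ^+ 2 / 4 * L) iE.
    exact: eq_integrable.
  apply: ge0_le_integral => //.
  - by move=> x _; rewrite lee_fin mulr_ge0 ?sqr_ge0// ltW.
  - apply/measurable_EFinP; apply: measurable_funM => //.
    exact: measurable_grad_norm_sqr.
  - apply/measurable_EFinP; apply: measurable_funM => //.
    exact: measurable_expRM.
  - move=> x _; rewrite lee_fin.
    have dg : differentiable g x by case: Cg.
    rewrite (grad_norm_comp dg (dphi (g x))) exprMn [phi (g x) ^+ 2]h2.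
    have -> : (s / 2) ^+ 2 * expR (s * g x) * grad_norm g x ^+ 2 * Omega x =
      s ^+ 2 / 4 * expR (s * g x) * (Omega x * grad_norm g x ^+ 2) by field.
    rewrite [leRHS]mulrAC ler_wpM2l// mulr_ge0 ?expR_ge0//.
    by rewrite divr_ge0 ?sqr_ge0.
have /wlsi : (@Cc_infty R n `|` energy_domain nu Omega) h.
  right; split => //; last exact: le_lt_trans en (ltry _).
  by under eq_fun do rewrite h2.
have C0 : (0 <= C%:E)%E by rewrite lee_fin ltW.
move=> /le_trans /(_ (lee_wpmul2l C0 en)).
rewrite (_ : (fun x => h x ^+ 2) = (fun x => expR (s * g x))); last first.
  by apply/funext => x; exact: h2.
rewrite /Ent; under eq_integral do rewrite expRK mulrC.
rewrite -[X in (X - _)%E]fineK; last exact: fin_num_integral iME.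
rewrite -EFinB -EFinM lee_fin => /le_trans; apply.
by rewrite le_eqVlt; apply/orP; left; apply/eqP; field.
Qed.

End LSI.

(** * Smooth truncation *)

Section Truncation.
Context (R : realType).

(** A cutoff that is rational, hence has elementary derivative and bounds, is
    bounded for e > 0, and contracts both values and slopes. *)
Definition trunc (e y : R) := y / (1 + e * y ^+ 2).

Definition dtrunc (e y : R) := (1 - e * y ^+ 2) / (1 + e * y ^+ 2) ^+ 2.

Let den (e y : R) := 1 + e * y ^+ 2.

Lemma den_ge1 (e y : R) : 0 <= e -> 1 <= den e y.
Proof. by move=> e0; rewrite /den lerDl mulr_ge0 ?sqr_ge0. Qed.

Lemma is_derive_trunc (e y : R) : 0 <= e -> is_derive y 1 (trunc e) (dtrunc e y).
Proof.
move=> e0.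
have den0 : den e y != 0 by rewrite gt_eqF// (lt_le_trans ltr01)// den_ge1.
have dden : is_derive y 1 (den e) (e * (2 * y)).
  apply: is_derive_eq.
  rewrite /GRing.scale/=; ring.
have dV : is_derive y 1 (fun y : R => (den e y)^-1) (- (den e y) ^- 2 * (e * (2 * y))).
  apply: DeriveDef; first by apply: derivableV => //; case: dden.
  by rewrite deriveV//; case: dden => // _ ->.
have -> : trunc e = (id : R -> R) * (fun y : R => (den e y)^-1) by apply/funext.
apply: is_derive_eq.
rewrite /GRing.scale/= mulr1 /dtrunc -/(den e y).
by rewrite /den; field.
Qed.

Lemma continuous_dtrunc (e : R) : 0 <= e -> continuous (dtrunc e).
Proof.
move=> e0 y.
have csq : {for y, continuous (fun y : R => e * y ^+ 2)}.
  by apply: cvgM; [exact: cvg_cst|exact: exprn_continuous].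
have cden : {for y, continuous (den e)} by apply: cvgD => //; exact: cvg_cst.
have den0 : den e y != 0 by rewrite gt_eqF// (lt_le_trans ltr01)// den_ge1.
apply: cvgM; first by apply: cvgB => //; exact: cvg_cst.
apply: cvgV; first by rewrite expf_neq0.
by apply: cvgM.
Qed.

Lemma sqr_dtrunc_le1 (e y : R) : 0 <= e -> dtrunc e y ^+ 2 <= 1.
Proof.
move=> e0; have den1 := den_ge1 y e0.
rewrite -(@real_normK _ (dtrunc e y)) ?num_real// -[leRHS](expr1n _ 2).
rewrite lerXn2r ?nnegrE//.
rewrite /dtrunc normrM normfV ler_pdivrMr ?mul1r; last first.
  by rewrite normr_gt0 expf_neq0// gt_eqF// (lt_le_trans ltr01).
rewrite [leRHS]ger0_norm ?sqr_ge0//.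
have := mulr_ge0 e0 (sqr_ge0 y); set q := e * y ^+ 2 => q0.
by rewrite ler_norml; nra.
Qed.

Lemma norm_trunc_le (e y : R) : 0 <= e -> `|trunc e y| <= `|y|.
Proof.
move=> e0; have den1 := den_ge1 y e0.
rewrite /trunc normrM normfV ler_piMr// invf_le1.
  by rewrite ger0_norm// (le_trans ler01).
by rewrite normr_gt0 gt_eqF// (lt_le_trans ltr01).
Qed.

Lemma norm_trunc_leV (e y : R) : 0 < e -> e <= 1 -> `|trunc e y| <= e^-1.
Proof.
move=> e0 e1; have den1 := den_ge1 y (ltW e0).
have d0 : 0 < 1 + e * y ^+ 2 by rewrite (lt_le_trans ltr01).
rewrite /trunc normrM normfV (ger0_norm (ltW d0)) ler_pdivrMr//.
rewrite mulrC ler_pdivlMr// mulrC -(@real_normK _ y) ?num_real//.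
(* With u = |y|, the claim e u <= 1 + e u^2 follows from u <= 1 + u^2 and e <= 1. *)
set u := `|y|; have := mulr_ge0 (ltW e0) (sqr_ge0 (u - 1 / 2)); lra.
Qed.

Lemma trunc_cvg (y : R) : trunc (k.+1%:R^-1) y @[k --> \oo] --> y.
Proof.
rewrite -[X in _ --> X](divr1 y).
apply: cvgM; first exact: cvg_cst.
apply: cvgV; first exact: oner_neq0.
rewrite -[X in _ --> X]addr0 -[X in _ --> _ + X](mul0r (y ^+ 2)).
apply: cvgD; first exact: cvg_cst.
apply: cvgM; last exact: cvg_cst.
exact: cvg_harmonic.
Qed.

End Truncation.

(** * The sub-Gaussian bound *)

Unset Implicit Arguments.

Theorem lemma5p1 (R : realType) (n : nat)
    (nu : probability (borelRn R n) R)
    (Omega : 'rV[R]_n -> R) (C : R)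
    (Omega_meas : measurable_fun [set: borelRn R n] (Omega : borelRn R n -> R))
    (Omega_gt0 : forall x, 0 < Omega x)
    (C_gt0 : 0 < C)
    (wlsi : weighted_log_sobolev nu Omega C) :
  forall f : 'rV[R]_n -> R,
    Ck 1 f ->
    (sup_norm (fun x => (Omega x * grad_norm f x ^+ 2)%R) < +oo)%E ->
    nu.-integrable [set: borelRn R n] (EFin \o (f : borelRn R n -> R)) /\
    forall t : R,
      (\int[nu]_x (expR (t * f x))%:E <=
       (expR (t * (\int[nu]_x f x)%R
              + C * fine (sup_norm (fun x => (Omega x * grad_norm f x ^+ 2)%R))
                / 4 * t ^+ 2))%:E)%E.
Proof.
move=> f Cf supf; set S := sup_norm _ in supf *.
pose L := fine S.
have leL x : Omega x * grad_norm f x ^+ 2 <= L.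
  have leS : (`|Omega x * grad_norm f x ^+ 2|%:E <= S)%E.
    by apply: ereal_sup_ubound; exists x.
  have Sfin : S \is a fin_num.
    by rewrite ge0_fin_numE// (le_trans _ leS)// lee_fin.
  by rewrite -lee_fin fineK// (le_trans _ leS)// lee_fin ler_norm.
pose e (k : nat) : R := k.+1%:R^-1.
have e0 k : 0 < e k by rewrite invr_gt0.
have e1 k : e k <= 1 by rewrite invf_le1// ler1n.
pose f_ k := trunc (e k) \o f.
have Cf_ k : Ck 1 (f_ k).
  apply: (Ck1_comp Cf (fun y => is_derive_trunc y (ltW (e0 k)))).
  exact: continuous_dtrunc (ltW (e0 k)).
have mC1 h : Ck 1 h ->
    measurable_fun [set: borelRn R n] (h : borelRn R n -> R).
  by move=> [dh _]; apply: continuous_borelRn => x; exact: differentiable_continuous.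
have leL_ k x : Omega x * grad_norm (f_ k) x ^+ 2 <= L.
  have df : differentiable f x by case: Cf.
  rewrite (grad_norm_comp df (is_derive_trunc (f x) (ltW (e0 k)))).
  apply: le_trans (leL x); rewrite ler_pM2l// ler_piMl ?sqr_ge0//.
  exact: sqr_dtrunc_le1 (ltW (e0 k)).
have f_M k x : `|f_ k x| <= (e k)^-1 by exact: norm_trunc_leV.
apply: (@laplace_limit _ _ _ nu f f_ (fun k => (e k)^-1)) => //.
- exact: mC1.
- by move=> k; exact: mC1.
- by move=> k x; exact: norm_trunc_le (ltW (e0 k)).
- by move=> x; exact: trunc_cvg.
- by move=> k; exact: (lsi_laplace_bounded Omega_meas Omega_gt0 C_gt0 wlsi (Cf_ k) (f_M k) (leL_ k)).
Qed.
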